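(* Let $k^+,k^-$ be positive integers and let $Z$ be a planar Filippov vector field having a $(2k^+,2k^-)$-tangential center at a point $p$ of its discontinuity manifold $\Sigma$. Then $p$ is not isochronous.
   Context: A planar Filippov vector field is a piecewise smooth vector field, defined on an open subset of $\mathbb{R}^2$, $$Z(x,y)=\begin{cases} Z^+(x,y), & h(x,y)>0,\\ Z^-(x,y), & h(x,y)<0,\end{cases}$$ where $Z^+$ and $Z^-$ are smooth vector fields (each defined and smooth on the whole open set), $h$ is a smooth real function having $0$ as a regular value, and $\Sigma=h^{-1}(0)$ is the discontinuity manifold. Trajectories follow Filippov's convention; in particular, at points $q\in\Sigma$ where $Z^+h(q)\cdot Z^-h(q)>0$, trajectories cross $\Sigma$ by concatenating a trajectory of one of $Z^\pm$ with a trajectory of the other. Lie derivatives: for a smooth vector field $F$, $Fh(p)=\langle \nabla h(p),F(p)\rangle$ and $F^nh(p)=F(F^{n-1}h)(p)$ for $n>1$. A point $p\in\Sigma$ is a $k$-multiplicity contact between $F$ and $\Sigma$ if $Fh(p)=F^2h(p)=\dots=F^{k-1}h(p)=0$ and $F^kh(p)\neq 0$. A $2k$-multiplicity contact $p$ is invisible for $Z^+$ (resp. $Z^-$) if $(Z^+)^{2k}h(p)<0$ (resp. $(Z^-)^{2k}h(p)>0$). A point $p\in\Sigma$ is a $(2k^+,2k^-)$-monodromic tangential singularity of $Z$ if $p$ is simultaneously an invisible $2k^+$-multiplicity contact of $Z^+$ with $\Sigma$ and an invisible $2k^-$-multiplicity contact of $Z^-$ with $\Sigma$, and $Z$ has a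 first-return map defined on $\Sigma$ around $p$ (obtained by concatenating the trajectory arcs of $Z^+$ in $h\ge 0$ and of $Z^-$ in $h\le 0$). It is called a $(2k^+,2k^-)$-tangential center if it has a neighborhood where the first-return map is the identity; thus, near $p$, every trajectory of $Z$ other than $p$ is a closed orbit made of one arc of $Z^+$ and one arc of $Z^-$. The period function assigns to each point $q\neq p$ of $\Sigma$ near $p$, lying on one fixed side of $p$ in $\Sigma$, the period of the closed trajectory of $Z$ through $q$ (the time of the $Z^+$ arc plus the time of the $Z^-$ arc). The center $p$ is isochronous if the period function is constant near $p$, i.e. if all (nonconstant) trajectories in a neighborhood of $p$ have the same period. *)

(* Defs.v *)
From mathcomp Require Import all_boot all_order all_algebra.
From mathcomp Require Import all_classical all_reals all_analysis.

Set Implicit Arguments.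
Unset Strict Implicit.
Unset Printing Implicit Defensive.

Import Order.TTheory GRing.Theory Num.Theory.
Import numFieldNormedType.Exports.

Local Open Scope classical_set_scope.
Local Open Scope ring_scope.

Section Plane.
Context {R : realType}.
Implicit Types (U : set (R * R)) (f h : R * R -> R) (F : R * R -> R * R).

Definition dx f : R * R -> R := fun p => 'D_((1, 0) : R * R) f p.
Definition dy f : R * R -> R := fun p => 'D_((0, 1) : R * R) f p.

(* Functions are total; only their values on the open set [U] matter. *)
Fixpoint Ck U (n : nat) f : Prop :=
  match n with
  | 0 => forall p, U p -> {for p, continuous f}
  | m.+1 => [/\ forall p, U p -> differentiable f p,
                Ck U m (dx f) & Ck U m (dy f)]
  end.

Definition smooth U f := forall n, Ck U n f.

Definition smooth_field U F :=
  smooth U (fun p => (F p).1) /\ smooth U (fun p => (F p).2).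

Definition dot (u v : R * R) : R := u.1 * v.1 + u.2 * v.2.

Definition grad f : R * R -> R * R := fun p => (dx f p, dy f p).

Definition lie F f : R * R -> R := fun p => dot (grad f p) (F p).

Definition lie_iter F n h : R * R -> R := iter n (lie F) h.

End Plane.

Record filippov (R : realType) := Filippov {
  dom : set (R * R);
  zp : R * R -> R * R;
  zm : R * R -> R * R;
  hfun : R * R -> R;
  dom_open : open dom;
  zp_smooth : smooth_field dom zp;
  zm_smooth : smooth_field dom zm;
  hfun_smooth : smooth dom hfun;
  hfun_regular : forall q, dom q -> hfun q = 0 -> grad hfun q <> 0 }.

Section Tangential.
Context {R : realType}.
Implicit Types (Z : filippov R) (F : R * R -> R * R) (p q r : R * R).

Definition Sigma Z : set (R * R) := [set q | dom Z q /\ hfun Z q = 0].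

Definition contact Z F (k : nat) p : Prop :=
  [/\ Sigma Z p,
      forall i, (0 < i < k)%N -> lie_iter F i (hfun Z) p = 0
    & lie_iter F k (hfun Z) p <> 0].

Definition invisible_plus Z (k : nat) p : Prop :=
  contact Z (zp Z) k.*2 p /\ lie_iter (zp Z) k.*2 (hfun Z) p < 0.

Definition invisible_minus Z (k : nat) p : Prop :=
  contact Z (zm Z) k.*2 p /\ 0 < lie_iter (zm Z) k.*2 (hfun Z) p.

(* [r] is the first point of Sigma reached, at time [t > 0], by the trajectory
   of [F] issued from [q] in Sigma and lying in the open region [S] in between. *)
Definition field_arc Z F (S : set (R * R)) q r (t : R) : Prop :=
  [/\ Sigma Z q, Sigma Z r, 0 < t &
    exists g : R -> R * R,
      [/\ g 0 = q, g t = r, {within `[0, t], continuous g} &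
          forall s, 0 < s < t -> is_derive s (1 : R) g (F (g s)) /\ S (g s)]].

Definition arc_plus Z :=
  field_arc Z (zp Z) [set q | dom Z q /\ 0 < hfun Z q].

Definition arc_minus Z :=
  field_arc Z (zm Z) [set q | dom Z q /\ hfun Z q < 0].

Definition crossing Z q : Prop :=
  Sigma Z q /\ 0 < lie (zp Z) (hfun Z) q * lie (zm Z) (hfun Z) q.

(* The orbit of [q] turns once around the singularity: it crosses Sigma at [q],
   follows one arc to a crossing point [m] on the other side of the singularity,
   and then an arc of the other field to [r]; [T] is the total time. The sign of
   the Lie derivatives at [q] decides which field comes first. *)
Definition first_return Z q r (T : R) : Prop :=
  exists m t1 t2,
    [/\ crossing Z q, crossing Z m, T = t1 + t2 &
        (arc_plus Z q m t1 /\ arc_minus Z m r t2) \/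
        (arc_minus Z q m t1 /\ arc_plus Z m r t2)].

Definition monodromic_tangential Z (kp km : nat) p : Prop :=
  [/\ invisible_plus Z kp p, invisible_minus Z km p &
      \forall q \near p, Sigma Z q -> q <> p ->
        exists r T, first_return Z q r T].

Definition tangential_center Z (kp km : nat) p : Prop :=
  monodromic_tangential Z kp km p /\
  \forall q \near p, Sigma Z q -> q <> p ->
    forall r T, first_return Z q r T -> r = q.

Definition is_period Z q (T : R) : Prop := first_return Z q q T.

(* Near [p], the curve Sigma minus [p] has two branches, told apart by the sign
   of the component of [q - p] along the tangent vector (- dy h, dx h) at [p]. *)
Definition side Z p (b : bool) q : Prop :=
  Sigma Z q /\
  0 < (-1) ^+ b * dot (- dy (hfun Z) p, dx (hfun Z) p) (q - p).

(* At a center every closed orbit near [p] meets both sides, so the choice of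
   the side on which the period function is considered is immaterial. *)
Definition isochronous Z p : Prop :=
  exists (b : bool) (T : R),
    \forall q \near p, side Z p b q -> is_period Z q T.

End Tangential.

(* Main.v *)
Require Import Defs.
From mathcomp Require Import all_boot all_order all_algebra.
From mathcomp Require Import all_classical all_reals all_analysis.
From mathcomp Require Import ring lra.

Set Implicit Arguments.
Unset Strict Implicit.
Unset Printing Implicit Defensive.

Import Order.TTheory GRing.Theory Num.Theory.
Import numFieldNormedType.Exports.

Local Open Scope classical_set_scope.
Local Open Scope ring_scope.

(** The period of the closed orbit through a point [q] of Sigma tends to [0] as
    [q] tends to [p]; a constant period would therefore be smaller than every
    positive number, although periods are positive.

    The heart of the matter is that arcs issued from points near [p] are short
    ([field_arc_short]). Let [F] be one of the two fields, with a contact of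
    order [n] at [p], and let [g] be an arc of [F] on its side of Sigma, say
    [h > 0]. The function [s |-> h (g s)] has [i]-th derivative
    [lie_iter F i h (g s)]. At [s = 0] these derivatives are as small as desired
    for [i < n], because they vanish at [p]; the [n]-th one stays below some
    [- c < 0] as long as [g] stays near [p], because the contact is invisible.
    Integrating [n] times ([iterated_deriv_le]), for [0 <= s <= 1],
      [h (g s) <= n * eta - c * s ^ n / n!],
    which is negative at [s = eps] once [q] is so close to [p] that [eta] is
    small with respect to [eps ^ n]. Since [h] is positive along the interior of
    the arc, the arc ends before the time [eps]. That [g] stays near [p] during
    this time follows from a bound on the speed ([trajectory_drift]).

    A short arc of bounded speed also ends near [p], so the second arc of the
    orbit is short as well ([first_return_short]). Finally, [0] being a regular
    value of [h], each side of Sigma has points arbitrarily close to [p]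
    ([exists_side_near]), at which the period can be evaluated. *)

(** * Calculus in normed spaces *)

Section Calculus.
Context {R : realType}.
Implicit Types (V W : normedModType R).

(** The Frechet expansion of [f] at [x] is one of [g]. This lets derivatives
    be computed with formulas that hold on an open set only. *)
Lemma near_eq_diff V W (f g : V -> W) (x : V) :
  (\near x, f x = g x) -> differentiable f x -> differentiable g x.
Proof.
move=> fg df; have fgx := nbhs_singleton fg.
have dc := diff_continuous df.
have E : g \o shift x = cst (g x) + 'd f x +o_ 0 id.
  apply/eqaddoP => e e0.
  have /eqaddoP/(_ e e0) := diff_locally df.
  have fg0 : \forall h \near 0, f (h + x) = g (h + x).
    rewrite (near_shift x); near do rewrite /= sub0r subrK; exact: fg.
  by apply: filterS2 fg0 => h; rewrite /= !fctE /= fgx => ->.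
by apply/diff_locallyP; rewrite (diff_unique dc E).
Unshelve. all: by end_near. Qed.

Lemma is_derive_along V W (h : V -> W) (g : R -> V) (s : R) (v : V) :
  differentiable h (g s) -> is_derive s 1 g v ->
  is_derive s 1 (h \o g) ('d h (g s) v).
Proof.
move=> dh [/derivable1_diffP dg gE].
have dhg := differentiable_comp dg dh.
apply: DeriveDef; first exact/derivable1_diffP.
by rewrite deriveE// diff_comp//= -gE deriveE.
Qed.

Lemma diff_partials (f : R * R -> R) (p v : R * R) :
  differentiable f p -> 'd f p v = dx f p * v.1 + dy f p * v.2.
Proof.
move=> df; rewrite /dx /dy !deriveE//.
have {1}-> : v = v.1 *: (1, 0) + v.2 *: (0, 1).
  by case: v => a b; congr (_, _); rewrite /= scaler0 ?addr0 ?add0r [RHS]mulr1.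
by rewrite linearD !linearZ /= mulrC [X in _ + X]mulrC.
Qed.

Lemma is_derive_fst (g : R -> R * R) (s : R) v :
  is_derive s 1 g v -> is_derive s 1 (fun u => (g u).1) v.1.
Proof.
move=> dg; have cf : continuous (fst : {linear (R * R)%type -> R}).
  by move=> x; exact: cvg_fst.
have := is_derive_along (linear_differentiable (g s) cf) dg.
by rewrite diff_lin.
Qed.

Lemma is_derive_snd (g : R -> R * R) (s : R) v :
  is_derive s 1 g v -> is_derive s 1 (fun u => (g u).2) v.2.
Proof.
move=> dg; have cf : continuous (snd : {linear (R * R)%type -> R}).
  by move=> x; exact: cvg_snd.
have := is_derive_along (linear_differentiable (g s) cf) dg.
by rewrite diff_lin.
Qed.

(** The time [c] is the infimum of the times at which [f] is at least [v]; by
    continuity this infimum is attained. *)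
Lemma first_reach (f : R -> R) (a b v : R) :
  a <= b -> {within `[a, b], continuous f} -> v <= f b ->
  exists2 c, c \in `[a, b] & v <= f c /\ forall x, a <= x < c -> f x < v.
Proof.
move=> ab cf vb; pose A := [set x | a <= x <= b /\ v <= f x].
have hA : has_inf A.
  split; first by exists b; split; rewrite ?lexx ?ab.
  by exists a => x [/andP[]].
have ac : a <= inf A by apply: (lb_le_inf hA.1) => x [/andP[]].
have cb : inf A <= b.
  by apply: (ge_inf hA.2); split; rewrite ?lexx ?ab.
exists (inf A); first by rewrite in_itv/= ac.
split=> [|x /andP[ax xc]]; last first.
  rewrite ltNge; apply/negP => vx.
  have : inf A <= x.
    by apply: (ge_inf hA.2); split; rewrite ?ax// ltW// (lt_le_trans xc).
  by rewrite leNgt xc.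
rewrite leNgt; apply/negP => fcv.
move/subspace_continuousP : cf => /(_ (inf A)).
rewrite /= in_itv/= ac cb => /(_ isT) cf.
have := cf _ (lt_nbhsl fcv).
rewrite nbhs_simpl /= => /nbhs_normP[d /= d0 dA].
have [x [/andP[ax xb] vx] xd] := inf_adherent d0 hA.
have cx : inf A <= x by apply: (ge_inf hA.2); split; rewrite ?ax ?xb.
have : f x < v.
  apply: dA; last by rewrite /= in_itv/= ax.
  by rewrite /ball_/= distrC ger0_norm ?subr_ge0// ltrBlDl.
by rewrite ltNge vx.
Qed.

(** For [a = m * eta] the derivative is the bound of [iterated_deriv_le] for
    [m], which this antiderivative carries to [m.+1]. *)
Lemma is_derive_affine_monomial (a c u : R) (m : nat) :
  is_derive u 1 (fun x : R => a * x - c * (x ^+ m.+1 / m.+1`!%:R))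
    (a - c * (u ^+ m / m`!%:R)).
Proof.
have -> : (fun x : R => a * x - c * (x ^+ m.+1 / m.+1`!%:R)) =
    a *: id - (c / m.+1`!%:R) *: (@id R) ^+ m.+1.
  by apply/funext => x; rewrite !fctE /GRing.scale/= mulrA [c * _ / _]mulrAC.
apply: is_derive_eq; rewrite /GRing.scale/= !mulr1.
congr (_ - _); rewrite factS natrM /= -mulr_natl.
by field; rewrite nat1r !pnatr_eq0 -!lt0n fact_gt0.
Qed.

(** A one-sided Taylor estimate, obtained by integrating [phi n <= - c], [m]
    times from [0]. Each integration adds an initial value, at most [eta], and
    multiplies the part in [eta] by a time at most [e <= 1], whence the
    crude but simple coefficient [m] of [eta]. *)
Lemma iterated_deriv_le (phi : nat -> R -> R) (n : nat) (c eta e : R) :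
  0 <= eta -> e <= 1 ->
  (forall i (s : R), (i < n)%N -> 0 < s < e ->
     is_derive s 1 (phi i) (phi i.+1 s)) ->
  (forall i, (i < n)%N -> {within `[0, e], continuous phi i}) ->
  (forall i, (i < n)%N -> phi i 0 <= eta) ->
  (forall s : R, 0 <= s <= e -> phi n s <= - c) ->
  forall m (s : R), (m <= n)%N -> 0 <= s <= e ->
    phi (n - m)%N s <= m%:R * eta - c * (s ^+ m / m`!%:R).
Proof.
move=> eta0 e1 dphi cphi phi0 phin.
elim=> [|m IHm] s mn /andP[s0 se].
  by rewrite subn0 mul0r sub0r expr0 fact0 divr1 mulr1 phin// s0.
set i := (n - m.+1)%N.
have iS : i.+1 = (n - m)%N by rewrite /i subnSK.
have ilt : (i < n)%N by rewrite /i ltn_subrL (leq_ltn_trans _ mn).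
pose P (u : R) : R := m%:R * eta * u - c * (u ^+ m.+1 / m.+1`!%:R).
pose dP (u : R) : R := m%:R * eta - c * (u ^+ m / m`!%:R).
have dPE (u : R) : is_derive u 1 P (dP u) := is_derive_affine_monomial _ _ _ _.
have dpsi (u : R) : 0 < u < e -> is_derive u 1 (phi i \- P) (phi i.+1 u - dP u).
  by move=> ue; have := dphi _ _ ilt ue => ?; apply: is_deriveB.
have cpsi : {within `[0, e], continuous (phi i \- P)}.
  move=> x; apply: cvgB; first exact: cphi.
  apply: continuous_subspaceT => {}x.
  by apply/differentiable_continuous/derivable1_diffP; have [] := dPE x.
(* By induction [phi i - P] has a nonpositive derivative. *)
have : (phi i \- P) s <= (phi i \- P) 0.
  apply: (@ler0_derive1_nincr _ _ 0 e) => // u; rewrite in_itv/= => ue.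
    by have [] := dpsi u ue.
  have [_ ] := dpsi u ue; rewrite derive1E => ->.
  rewrite subr_le0 iS; apply: IHm; first exact: ltnW.
  by case/andP: ue => /ltW-> /ltW.
rewrite /P /= mulr0 expr0n /= mul0r mulr0 subr0 subr0 => H.
have {H} := le_trans H (phi0 _ ilt).
rewrite -natr1; have : m%:R * eta * s <= m%:R * eta.
  by rewrite ler_piMr ?mulr_ge0// (le_trans se).
by lra.
Qed.

End Calculus.

(** * Smooth functions on an open set of the plane *)

Section Smoothness.
Context {R : realType} (U : set (R * R)) (oU : open U).
Implicit Types (f g h : R * R -> R) (F : R * R -> R * R).

Lemma open_near (p : R * R) : U p -> \forall x \near p, U x.
Proof. by move=> Up; exact: open_nbhs_nbhs. Qed.

Lemma CkW n f : Ck U n.+1 f -> Ck U n f.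
Proof.
elim: n f => [|n IHn] f [df fx fy].
  by move=> p Up; exact/differentiable_continuous/df.
by split; [exact: df|exact: IHn fx|exact: IHn fy].
Qed.

(** Only the values on the open set matter, so the rules for the derivatives of
    sums and products, valid on [U] alone, suffice for [CkD] and [CkM]. *)
Lemma eq_Ck n f g : (forall p, U p -> f p = g p) -> Ck U n f -> Ck U n g.
Proof.
elim: n f g => [|n IHn] f g fg.
  move=> cf p Up; rewrite /prop_for/continuous_at -(fg p Up).
  apply: cvg_trans (cf p Up); apply: near_eq_cvg.
  by near do apply: fg; exact: open_near.
have nfg p : U p -> \forall x \near p, f x = g x.
  by move=> Up; near do apply: fg; exact: open_near.
move=> [df fx fy]; split=> [p Up||].
- exact: near_eq_diff (nfg p Up) (df p Up).
- by apply: IHn fx => p /nfg; exact: near_eq_derive.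
- by apply: IHn fy => p /nfg; exact: near_eq_derive.
Unshelve. all: by end_near. Qed.

Lemma CkD n f g : Ck U n f -> Ck U n g -> Ck U n (f \+ g).
Proof.
elim: n f g => [|n IHn] f g.
  by move=> cf cg p Up; apply: cvgD; [exact: cf|exact: cg].
move=> [df fx fy] [dg gx gy]; split=> [p Up||].
- by apply: differentiableD; [exact: df|exact: dg].
- apply: eq_Ck (IHn _ _ fx gx) => p Up.
  by rewrite /dx /= deriveD//; apply: diff_derivable; [exact: df|exact: dg].
- apply: eq_Ck (IHn _ _ fy gy) => p Up.
  by rewrite /dy /= deriveD//; apply: diff_derivable; [exact: df|exact: dg].
Qed.

Lemma CkM n f g : Ck U n f -> Ck U n g -> Ck U n (f \* g).
Proof.
elim: n f g => [|n IHn] f g.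
  by move=> cf cg p Up; apply: cvgM; [exact: cf|exact: cg].
move=> Cf Cg; have [df fx fy] := Cf; have [dg gx gy] := Cg.
have /CkW Cf' := Cf; have /CkW Cg' := Cg.
split=> [p Up||].
- by apply: differentiableM; [exact: df|exact: dg].
- apply: eq_Ck (CkD (IHn _ _ Cf' gx) (IHn _ _ Cg' fx)) => p Up.
  by rewrite /dx /= deriveM//; apply: diff_derivable; [exact: df|exact: dg].
- apply: eq_Ck (CkD (IHn _ _ Cf' gy) (IHn _ _ Cg' fy)) => p Up.
  by rewrite /dy /= deriveM//; apply: diff_derivable; [exact: df|exact: dg].
Qed.

Lemma smooth_differentiable f p : smooth U f -> U p -> differentiable f p.
Proof. by move=> /(_ 1%N)[df _ _]; exact: df. Qed.

Lemma smooth_continuous f p : smooth U f -> U p -> {for p, continuous f}.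
Proof. by move=> /(_ 0%N); exact. Qed.

Lemma smooth_lie F f : smooth_field U F -> smooth U f -> smooth U (lie F f).
Proof.
move=> [F1 F2] sf n; have [_ fx fy] := sf n.+1.
exact: (CkD (CkM fx (F1 n)) (CkM fy (F2 n))).
Qed.

Lemma smooth_lie_iter F f n :
  smooth_field U F -> smooth U f -> smooth U (lie_iter F n f).
Proof. by move=> sF sf; elim: n => //= n; exact: smooth_lie. Qed.

End Smoothness.

(** * Trajectories of a planar vector field *)

Section Trajectories.
Context {R : realType}.
Implicit Types (f g h : R * R -> R) (F : R * R -> R * R).

(** Applied to each [lie_iter F i f], this makes the iterated Lie derivatives
    the successive derivatives of [f] along a trajectory of [F]. *)
Lemma is_derive_lie F f (g : R -> R * R) (s : R) :
  differentiable f (g s) -> is_derive s 1 g (F (g s)) ->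
  is_derive s 1 (f \o g) (lie F f (g s)).
Proof.
by move=> df dg; have := is_derive_along df dg; rewrite diff_partials.
Qed.

(** The speed bound [M] is known only in the ball of radius [rho], so a drift of
    at most [M * s] requires the trajectory to remain there. It does: at the
    first time [c] when the distance to [q] is [rho], the mean value theorem up
    to [c] still gives a distance at most [M * c < rho]. *)
Lemma trajectory_drift F (g : R -> R * R) (q : R * R) (M rho tau : R) :
  g 0 = q -> {within `[0, tau], continuous g} ->
  (forall s : R, 0 < s < tau -> is_derive s 1 g (F (g s))) ->
  (forall x, `|q - x| < rho -> `|F x| <= M) -> M * tau < rho -> 0 < rho ->
  forall s, 0 <= s <= tau -> `|q - g s| <= M * s.
Proof.
move=> g0 cg dg FM Mtau rho0.
have M0 : 0 <= M by apply: le_trans (FM q _); rewrite ?subrr ?normr0.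
have drift (s : R) : 0 <= s <= tau ->
    (forall u : R, 0 <= u < s -> `|q - g u| < rho) -> `|q - g s| <= M * s.
  move=> /andP[]; rewrite le_eqVlt => /predU1P[<-|s0] st inside.
    by rewrite g0 subrr normr0 mulr0.
  have cgs : {within `[0, s], continuous g}.
    by apply: continuous_subspaceW cg; apply: subset_itvl; rewrite bnd_simp.
  (* The mean value theorem is applied to each coordinate; the norm of the
     plane is the maximum of the two. *)
  have coord (pr : R * R -> R) : continuous pr ->
      (forall x y, pr (x - y) = pr x - pr y) -> (forall x, `|pr x| <= `|x|) ->
      (forall (u : R) v, is_derive u 1 g v -> is_derive u 1 (pr \o g) (pr v)) ->
      `|pr (q - g s)| <= M * s.
    move=> cpr prB pr_le dpr; rewrite prB distrC -g0.
    have [u||c] := @MVT _ (pr \o g) (fun u => pr (F (g u))) 0 s s0.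
    - rewrite in_itv/= => /andP[u0 us]; apply: dpr; apply: dg.
      by rewrite u0 (lt_le_trans us).
    - by move=> x; apply: (cvg_comp _ _ (cgs x)); exact: cpr.
    rewrite in_itv/= subr0 => /andP[c0 cs] /= ->.
    rewrite normrM (gtr0_norm s0) ler_pM2r// (le_trans (pr_le _))//.
    by apply: FM; apply: inside; rewrite ltW.
  rewrite prod_normE ge_max; apply/andP; split.
  - apply: (coord fst) => //; first by move=> x; exact: cvg_fst.
      by move=> x; rewrite prod_normE le_max lexx.
    by move=> u v; exact: is_derive_fst.
  - apply: (coord snd) => //; first by move=> x; exact: cvg_snd.
      by move=> x; rewrite prod_normE le_max lexx orbT.
    by move=> u v; exact: is_derive_snd.
move=> s /andP[s0 st]; apply: (drift s); first by rewrite s0.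
move=> v /andP[v0 vs]; rewrite ltNge; apply/negP => vrho.
have cgv : {within `[0, v], continuous (fun u => `|q - g u|)}.
  have cgv : {within `[0, v], continuous g}.
    apply: continuous_subspaceW cg; apply: subset_itvl.
    by rewrite bnd_simp (le_trans (ltW vs)).
  by move=> x; apply: cvg_norm; apply: cvgB; [exact: cvg_cst|exact: cgv].
have [c] := first_reach v0 cgv vrho.
rewrite in_itv/= => /andP[c0 cv] [rhoc inside].
have ct : c <= tau by rewrite (le_trans cv)// (le_trans (ltW vs)).
have : `|q - g c| <= M * c by apply: (drift c) => //; rewrite c0.
apply/negP; rewrite -ltNge (lt_le_trans _ rhoc)// (le_lt_trans _ Mtau)//.
by rewrite ler_wpM2l.
Qed.

End Trajectories.

(** * Arcs near an invisible contact *)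

Section ShortArcs.
Context {R : realType}.
Implicit Types (Z : filippov R) (F : R * R -> R * R) (p q r : R * R).

(** The sign [sg] treats both fields at once: it is [1] for the arcs in [h > 0]
    and [-1] for those in [h < 0]. That the end point [r] is near [p] is what
    makes the next arc short in turn. *)
Lemma field_arc_short Z F (S : set (R * R)) (sg : R) (n : nat) p :
  smooth_field (dom Z) F -> dom Z p ->
  (forall i, (i < n)%N -> lie_iter F i (hfun Z) p = 0) ->
  sg * lie_iter F n (hfun Z) p < 0 ->
  (forall x, S x -> 0 < sg * hfun Z x) ->
  forall e : R, 0 < e ->
  \forall q \near p, forall r t, field_arc Z F S q r t ->
    t < e /\ `|p - r| < e.
Proof.
move=> sF Up Lp Ln Spos e e0.
pose L i x := sg * lie_iter F i (hfun Z) x.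
have sL i : smooth (dom Z) (lie_iter F i (hfun Z)).
  by apply: smooth_lie_iter; [exact: dom_open|exact: sF|exact: hfun_smooth].
have cL i x : dom Z x -> {for x, continuous (L i)}.
  by move=> Ux; apply: cvgMr; exact: smooth_continuous Ux.
have cF : {for p, continuous F}.
  have -> : F = fun x => ((F x).1, (F x).2) by apply/funext => x; case: (F x).
  by apply: (@cvg_pair _ _ _ _ (nbhs (F p).1) (nbhs (F p).2));
    [exact: smooth_continuous sF.1 Up|
     exact: smooth_continuous sF.2 Up].
pose M := `|F p| + 1.
have M0 : 0 < M by rewrite /M ltr_pwDr.
pose c := - L n p / 2.
have c0 : 0 < c by rewrite divr_gt0// oppr_gt0.
have : \forall x \near p, [/\ dom Z x, `|F x| <= M & L n x <= - c].
  have FM : \forall x \near p, `|F x| < M.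
    by apply: (cvgr_norm_lt (F p) cF); rewrite /M ltrDl.
  have Lc : \forall x \near p, L n x < - c.
    apply: (cvgr_lt (L n p) (cL n p Up)).
    have := Ln; rewrite -/(L n p) /c; lra.
  have nearU := open_near (@dom_open _ Z) Up.
  near=> x; split; first by near: x; exact: nearU.
    by apply: ltW; near: x; exact: FM.
  by apply: ltW; near: x; exact: Lc.
move=> /nbhs_normP[rho /= rho0 near_p].
pose d := Num.min rho e.
have d0 : 0 < d by rewrite /d lt_min rho0.
(* During a time [eps] a trajectory of speed at most [M] moves by at most
   [d / 4], and so does not leave the ball of radius [d] if it starts within
   [d / 2] of its centre; [eps <= 1] is required by [iterated_deriv_le]. *)
pose eps := Num.min 1 (d / (4 * M)).
have eps0 : 0 < eps by rewrite /eps lt_min ltr01 divr_gt0// mulr_gt0.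
have eps1 : eps <= 1 by rewrite /eps ge_min lexx.
have Meps : M * eps <= d / 4.
  have : eps <= d / (4 * M) by rewrite /eps ge_min lexx orbT.
  rewrite -(ler_pM2l M0) => /le_trans; apply.
  have -> : M * (d / (4 * M)) = d / 4 by field; rewrite gt_eqF.
  exact: lexx.
have eps_e : eps < e.
  have : eps <= M * eps by apply: ler_peMl; [exact: ltW|rewrite /M lerDr].
  have : d <= e by rewrite /d ge_min lexx orbT.
  lra.
(* Chosen so that [n * eta < c * eps ^ n / n!]. *)
pose eta := c * (eps ^+ n / n`!%:R) / n.+1%:R.
have k0 : 0 < c * (eps ^+ n / n`!%:R).
  by rewrite mulr_gt0// divr_gt0 ?exprn_gt0// ltr0n fact_gt0.
have eta0 : 0 < eta by rewrite divr_gt0.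
have small : \forall q \near p, forall i, (i < n)%N -> L i q < eta.
  have smallF i : (i < n)%N -> \forall q \near p, L i q < eta.
    move=> ilt; apply: (cvgr_lt (L i p) (cL i p Up)).
    by rewrite /L Lp// mulr0.
  have : \forall q \near p, forall i : 'I_n, L i q < eta.
    exact: (@filter_forall _ _ (fun (i : 'I_n) q => L i q < eta) (nbhs p) _
      (fun i => smallF i (ltn_ord i))).
  by apply: filterS => q Lq i ilt; exact: (Lq (Ordinal ilt)).
have close : \forall q \near p, `|p - q| < d / 2.
  by apply/nbhs_normP; exists (d / 2) => //=; rewrite divr_gt0.
near=> q => r t [_ _ t0 [g [g0 gt cg dg]]].
have pq : `|p - q| < d / 2 by near: q; exact: close.
have in_ball x : `|q - x| < d / 2 -> [/\ dom Z x, `|F x| <= M & L n x <= - c].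
  move=> qx; apply: near_p; rewrite /ball_ /=.
  have -> : p - x = (p - q) + (q - x) by rewrite addrA subrK.
  apply: le_lt_trans (ler_normD _ _) _.
  have : d <= rho by rewrite /d ge_min lexx.
  lra.
have drift tau : tau <= t -> tau <= eps ->
    forall s, 0 <= s <= tau -> `|q - g s| <= M * s.
  move=> taut taueps; apply: (@trajectory_drift _ F g q M (d / 2)) => //.
  - by apply: continuous_subspaceW cg; apply: subset_itvl; rewrite bnd_simp.
  - move=> s /andP[s0 st]; have [|//] := dg s.
    by rewrite s0 (lt_le_trans st).
  - by move=> x /in_ball[].
  - have : M * tau <= M * eps by rewrite ler_pM2l.
    lra.
  - by rewrite divr_gt0.
have teps : t <= eps.
  rewrite leNgt; apply/negP => epst.
  have in_tube s : 0 <= s <= eps ->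
      [/\ dom Z (g s), `|F (g s)| <= M & L n (g s) <= - c].
    move=> /andP[s0 se]; apply: in_ball.
    apply: (@le_lt_trans _ _ (M * s)); last first.
      have : M * s <= M * eps by rewrite ler_pM2l.
      lra.
    by apply: (drift eps); rewrite ?s0// ltW.
  (* If the arc lasted longer than [eps], the Taylor estimate would make
     [sg * h] negative at [g eps], which lies in [S]. *)
  have := @iterated_deriv_le _ (fun i s => L i (g s)) n c eta eps
    (ltW eta0) eps1 _ _ _ _ n eps (leqnn n).
  rewrite subnn ltW// lexx /= => H.
  have : L 0%N (g eps) < 0.
    apply: le_lt_trans (H _ _ _ _ isT) _.
    - move=> i s ilt /andP[s0 se].
      have [|Us _ _] := in_tube s; first by rewrite !ltW.
      apply: is_deriveZ.
      apply: is_derive_lie; first exact: smooth_differentiable Us.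
      by have [|] := dg s; first by rewrite s0 (lt_trans se).
    - move=> i ilt; apply/subspace_continuousP => s /=.
      rewrite in_itv/= => ses.
      have [Us _ _] := in_tube s ses.
      apply: (@cvg_comp _ _ _ g (L i)); last exact: (cL i _ Us).
      have cge : {within `[0, eps], continuous g}.
        by apply: continuous_subspaceW cg; apply: subset_itvl;
           rewrite bnd_simp ltW.
      by move/subspace_continuousP : cge; apply; rewrite /= in_itv.
    - move=> i ilt; rewrite g0 ltW//.
      by move: i ilt; near: q; exact: small.
    - by move=> s /in_tube[].
    have <- : n.+1%:R * eta = c * (eps ^+ n / n`!%:R).
      by rewrite mulrC /eta divfK// pnatr_eq0.
    by rewrite subr_lt0 ltr_pM2r// ltr_nat.
  have [|_ /Spos] := dg eps; first by rewrite eps0.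
  by rewrite /L /lie_iter /= => /ltW; rewrite leNgt => /negbTE ->.
split; first exact: le_lt_trans eps_e.
have := drift t (lexx _) teps t; rewrite gt lexx ltW// => /(_ isT) qr.
have -> : p - r = (p - q) + (q - r) by rewrite addrA subrK.
apply: le_lt_trans (ler_normD _ _) _.
have : M * t <= M * eps by rewrite ler_pM2l.
have : d <= e by rewrite /d ge_min lexx orbT.
lra.
Unshelve. all: by end_near.
Qed.

End ShortArcs.

(** * The two sides of the discontinuity curve *)

Section Sides.
Context {R : realType}.
Implicit Types (Z : filippov R) (F : R * R -> R * R) (p q r : R * R).

(** The side is prescribed by moving from [p] along the tangent [v] of Sigma by
    [s], which is a small [a > 0] with the sign given by [b]. A correction [u]
    along the normal [n] then brings the point back to Sigma:
    [h (p + s v + u n)] is [u N] up to an error small with respect to [a], so it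
    changes sign between [u = - a] and [u = a]. As [n] is orthogonal to [v],
    the correction does not affect the side. *)
Lemma exists_side_near Z p (b : bool) (P : set (R * R)) :
  Sigma Z p -> (\forall q \near p, P q) -> exists q, P q /\ side Z p b q.
Proof.
move=> [Up hp0] nP; set h := hfun Z in hp0.
have sh : smooth (dom Z) h by exact: hfun_smooth.
have dh : differentiable h p by exact: smooth_differentiable Up.
pose n : R * R := (dx h p, dy h p).
pose v : R * R := (- dy h p, dx h p).
pose N : R := n.1 ^+ 2 + n.2 ^+ 2.
have n_neq0 : n != 0.
  by apply/eqP; exact: (@hfun_regular _ Z p Up hp0).
pose K := `|n|.
have K0 : 0 < K by rewrite normr_gt0.
have vK : `|v| = K by rewrite /K !prod_normE/= normrN maxC.
have N0 : 0 < N.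
  rewrite lt_def addr_ge0 ?sqr_ge0// andbT paddr_eq0 ?sqr_ge0// !sqrf_eq0.
  by apply: contra n_neq0; case/andP => /= /eqP n1 /eqP n2; rewrite /n n1 n2.
(* The displacement has norm at most [2 a K], so this precision in the first
   order expansion keeps the error below [a N / 2]. *)
have /eqaddoP/(_ (N / (4 * K))) := diff_locally dh.
rewrite divr_gt0 ?mulr_gt0// => /(_ isT) /nbhs_normP[d1 /= d10 lin].
have nU := open_near (@dom_open _ Z) Up.
have /nbhs_normP[d2 /= d20 inPU] : \forall q \near p, P q /\ dom Z q.
  exact: filterI nP nU.
pose d := Num.min d1 d2.
have d0 : 0 < d by rewrite lt_min d10.
pose a := d / (4 * K).
have a0 : 0 < a by rewrite divr_gt0// mulr_gt0.
pose s : R := (-1) ^+ b * a.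
have sa : `|s| = a by rewrite normrM normrX normrN1 expr1n mul1r gtr0_norm.
pose k (u : R) : R * R := s *: v + u *: n.
have kK u : `|u| <= a -> `|k u| <= 2 * a * K.
  move=> ua; apply: le_trans (ler_normD _ _) _.
  rewrite (normrZ s v) (normrZ u n) vK sa -/K.
  have : `|u| * K <= a * K by rewrite ler_pM2r.
  lra.
have kd u : `|u| <= a -> `|k u| < d.
  move=> /kK; have -> : 2 * a * K = d / 2 by rewrite /a; field; rewrite gt_eqF.
  move=> /le_lt_trans; apply; lra.
have dhk u : 'd h p (k u) = u * N.
  rewrite diff_partials// /k /N /n /v /= /GRing.scale/=.
  by ring.
have hk u : `|u| <= a -> `|h (p + k u) - u * N| <= a * N / 2.
  move=> ua.
  have : `|h (k u + p) - (h p + 'd h p (k u))| <= N / (4 * K) * `|k u|.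
    apply: (lin (k u)); rewrite /ball_/= sub0r normrN.
    by rewrite (lt_le_trans (kd u ua))// /d ge_min lexx.
  rewrite hp0 add0r dhk (addrC _ p) => /le_trans; apply.
  have -> : a * N / 2 = N / (4 * K) * (2 * a * K).
    by field; rewrite gt_eqF.
  by rewrite ler_wpM2l ?kK// divr_ge0 ?mulr_ge0// ltW.
pose f u := h (p + k u).
have near_pk u : `|u| <= a -> P (p + k u) /\ dom Z (p + k u).
  move=> ua; apply: inPU; rewrite /ball_/= opprD addNKr normrN.
  by rewrite (lt_le_trans (kd u ua))// /d ge_min lexx orbT.
have cf : {within `[- a, a], continuous f}.
  apply/subspace_continuousP => u /=; rewrite in_itv/= -ler_norml => ua.
  apply: cvg_within_filter.
  apply: (@cvg_comp _ _ _ (fun u => p + k u) h); last first.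
    by apply: (smooth_continuous sh); have [] := near_pk u ua.
  apply: cvgD; first exact: cvg_cst.
  apply: cvgD; first exact: cvg_cst.
  by apply: cvgZr_tmp; exact: cvg_id.
have aa : - a <= a by lra.
have aN : 0 < a * N by rewrite mulr_gt0.
have fa : 0 < f a.
  have := hk a; rewrite gtr0_norm// lexx => /(_ isT).
  rewrite ler_norml -/(f a) => /andP[]; lra.
have fNa : f (- a) < 0.
  have := hk (- a); rewrite normrN gtr0_norm// lexx => /(_ isT).
  rewrite ler_norml -/(f (- a)) => /andP[]; lra.
have [|u] := @IVT _ f (- a) a 0 aa cf.
  by rewrite ge_min le_max (ltW fa) (ltW fNa) orbT.
rewrite in_itv/= -ler_norml => /near_pk[Pu Uu] fu0.
exists (p + k u); split => //; split; first by split.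
rewrite addrC addKr.
have -> : dot v (k u) = s * N.
  by rewrite /dot /k /v /n /N /= /GRing.scale/=; ring.
by rewrite /s mulrA mulrA -expr2 sqrr_sign mul1r.
Qed.

End Sides.

(** * The period near the singularity *)

(** The first arc is made shorter than [e / 2] and made to end so close to [p]
    that the second one is shorter than [e / 2] too. *)
Lemma first_return_short (R : realType) (kp km : nat) (Z : filippov R) p :
  invisible_plus Z kp p -> invisible_minus Z km p ->
  forall e : R, 0 < e ->
  \forall q \near p, forall r T, first_return Z q r T -> 0 < T < e.
Proof.
move=> [[[Up hp0] Lp _] Lpn] [[_ Lm _] Lmn] e e0.
have arcs (F : R * R -> R * R) (S : set (R * R)) (sg : R) k :
    smooth_field (dom Z) F ->
    (forall i, (0 < i < k)%N -> lie_iter F i (hfun Z) p = 0) ->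
    sg * lie_iter F k (hfun Z) p < 0 ->
    (forall x, S x -> 0 < sg * hfun Z x) -> forall e', 0 < e' ->
    \forall q \near p, forall r t, field_arc Z F S q r t ->
      t < e' /\ `|p - r| < e'.
  move=> sF L0 Ln SS; apply: (field_arc_short sF Up _ Ln SS) => -[|i] ik //.
  exact: L0.
have plus := arcs _ _ 1 _ (@zp_smooth _ Z) Lp _ _.
have minus := arcs _ _ (-1) _ (@zm_smooth _ Z) Lm _ _.
have arcs_short e' : 0 < e' -> \forall q \near p, forall r t,
    arc_plus Z q r t \/ arc_minus Z q r t -> t < e' /\ `|p - r| < e'.
  move=> e'0; near=> q => r t [].
    move: r t; near: q; apply: plus => //; first by rewrite mul1r.
    by move=> x [_]; rewrite mul1r.
  move: r t; near: q; apply: minus => //; first by rewrite mulN1r oppr_lt0.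
  by move=> x [_]; rewrite mulN1r oppr_gt0.
have e2 : 0 < e / 2 by rewrite divr_gt0.
(* Arcs issued within [d] of [p] last less than [e / 2]. *)
have /nbhs_normP[d /= d0 short2] := arcs_short _ e2.
have de : 0 < Num.min d (e / 2) by rewrite lt_min d0.
near=> q => r T [m [t1 [t2 [_ _ -> arcs12]]]].
have [a1 a2] : (arc_plus Z q m t1 \/ arc_minus Z q m t1) /\
    (arc_plus Z m r t2 \/ arc_minus Z m r t2).
  by case: arcs12 => -[]; split; [left|right|right|left].
have t10 : 0 < t1 by case: a1 => -[].
have t20 : 0 < t2 by case: a2 => -[].
have [] : t1 < Num.min d (e / 2) /\ `|p - m| < Num.min d (e / 2).
  by move: m t1 a1 {a2 t10 arcs12}; near: q; exact: arcs_short.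
rewrite !lt_min => /andP[_ t1e] /andP[pm _].
have [t2e _] := short2 m pm r t2 a2.
by apply/andP; split; lra.
Unshelve. all: by end_near. Qed.

Theorem theorem1 (R : realType) (kp km : nat) (hkp : (0 < kp)%N)
  (hkm : (0 < km)%N) (Z : filippov R) (p : R * R)
  (hc : tangential_center Z kp km p) : ~ isochronous Z p.
Proof.
move=> [b [T near_period]].
have [[inv_plus inv_minus _] _] := hc.
have Sp : Sigma Z p by have [[]] := inv_plus.
have Tlt e : 0 < e -> 0 < T < e.
  move=> e0; have short := first_return_short inv_plus inv_minus e0.
  have per_short : \forall q \near p, (side Z p b q -> is_period Z q T) /\
      (forall r T', first_return Z q r T' -> 0 < T' < e).
    exact: filterI near_period short.
  have [q [[per sh] sq]] := exists_side_near b Sp per_short.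
  exact: sh (per sq).
have /andP[T0 _] := Tlt 1 ltr01.
by have := Tlt T T0; rewrite ltxx andbF.
Qed.
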